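(* Consider the adaptive network running the distributed algorithm (U-sup) described in the context, and suppose that: (1) the network is at steady state, that is, all local filters have converged to their final mean-square deviation (MSD), the supervisors have converged to their final values, and the quantities $E\|w^o-\psi_{n,i}\|^2$ and $E\|w^o-w_{n,i}\|^2$ no longer depend on $i$ for every node $n$; (2) at steady state each local supervisor chooses the best option, in terms of MSD, between its local estimate and its neighborhood estimate, i.e. for every node $n$ $$E\|w^o-w_{n,i}\|^2\le \min\bigl\{E\|w^o-\psi_{n,i-1}\|^2,\;E\|w^o-\phi_{n,i-1}\|^2\bigr\};$$ (3) the local filters are independent, i.e. $L_n\to\infty$ for every $n$, meaning that the supervisor output is never transferred into the local filter ($\psi_{n,a}=\psi_{n,i-1}$ for all $n,i$). Then the algorithm is asymptotically universal with respect to the non-cooperative strategy: at steady state, for every node $n\in\{1,\dots,N\}$, the MSD of the output $w_{n,i}$ of node $n$ is no larger than the MSD that node $n$ attains when it operates independently of the rest of the network, i.e. when it runs the stand-alone filter $$\psi_{n,i}=\psi_{n,i-1}+H_{n,i}u_{n,i}^T\,[d_n(i)-u_{n,i}\psi_{n,i-1}]$$ and uses $\psi_{n,i-1}$ as its estimate of $w^o$.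
   Context: Network. There are $N$ nodes forming a graph. $\mathcal N_n$ is the set of nodes directly connected to node $n$, including $n$, and $\overline{\mathcal N}_n=\mathcal N_n\setminus\{n\}$ is the strict neighborhood. At each time $i$ node $n$ has access to a scalar measurement $d_n(i)$ and a random row regressor $u_{n,i}\in\mathbb R^{1\times M}$, with $d_n(i)=u_{n,i}w^o+v_n(i)$, where $w^o\in\mathbb R^{M}$ is an unknown vector common to all nodes and $v_n(i)$ is noise. $H_{n,i}$ is an $M\times M$ positive definite matrix defining the local adaptive rule (e.g. $H_{n,i}=\mu_n I$ for LMS, $H_{n,i}=\frac{\mu_n}{\|u_{n,i}\|^2+\epsilon}I$ for NLMS). $E$ denotes expectation and $\|\cdot\|$ the Euclidean norm; all second moments are assumed finite. Algorithm (U-sup). The fixed combiners satisfy $\overline c_{n\ell}\ge 0$, $\overline c_{n\ell}=0$ for $\ell\notin\overline{\mathcal N}_n$, and $\sum_{\ell\in\overline{\mathcal N}_n}\overline c_{n\ell}=1$. With constants $a_+>0$, $\mu_{a,n}>0$, $0<\nu_n<1$, $\epsilon_p>0$ and positive integers $L_n$, node $n$ performs at time $i$: $$\lambda_n(i)=\frac{1}{1+e^{-a_n(i-1)}},\qquad \check\lambda_n(i)=\begin{cases}\lambda_n(i), & -a_+<a_n(i-1)<a_+,\\ 0,& a_n(i-1)=-a_+,\\ 1,& a_n(i-1)=a_+,\end{cases}$$ $$\phi_{n,i-1}=\sum_{\ell\in\overline{\mathcal N}_n}\overline c_{n\ell}\,w_{\ell,i-1},\qquad w_{n,i}=\check\lambda_n(i)\,\psi_{n,i-1}+[1-\check\lambda_n(i)]\,\phi_{n,i-1},$$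 $$e_n(i)=d_n(i)-u_{n,i}w_{n,i},\qquad p_n(i)=\nu_np_n(i-1)+(1-\nu_n)|u_{n,i}(\psi_{n,i-1}-\phi_{n,i-1})|^2,$$ $$a_n(i)=\Bigl[a_n(i-1)+\tfrac{\mu_{a,n}}{p_n(i)+\epsilon_p}\,u_{n,i}(\psi_{n,i-1}-\phi_{n,i-1})\,e_n(i)\,\lambda_n(i)(1-\lambda_n(i))\Bigr]_{-a_+}^{a_+},$$ $$\psi_{n,a}=\delta_{L_n}(i)\,w_{n,i}+[1-\delta_{L_n}(i)]\,\psi_{n,i-1},\qquad \psi_{n,i}=\psi_{n,a}+H_{n,i}u_{n,i}^T[d_n(i)-u_{n,i}\psi_{n,a}],$$ where $[\cdot]_{-a_+}^{a_+}$ denotes truncation to $[-a_+,a_+]$, and $\delta_{L_n}(i)=1$ if $i=rL_n$ for some positive integer $r$ and $0$ otherwise. The pair ($\check\lambda_n(i)$, the formula for $w_{n,i}$) is called the local supervisor of node $n$; $\psi_{n,i}$ is the local filter estimate, $\phi_{n,i-1}$ the neighborhood estimate, and $w_{n,i}$ the output of node $n$. The stand-alone filter is started from the same initial condition as $\psi_n$ in the algorithm. Performance. The MSD of an estimate $x$ of $w^o$ is $E\|w^o-x\|^2$; the MSD of node $n$ in U-sup is $\mathrm{MSD}_n(i)=E\|w^o-w_{n,i}\|^2$. Definitions. A network is universal with respect to the non-cooperative strategy if every node performs at least as well as if it were independent of the rest of the network. Asymptotic means that the property holds at steady state ($i\to\infty$). *)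

(* Defs.v *)
From HB Require Import structures.
From mathcomp Require Import all_boot all_order all_algebra.
From mathcomp Require Import all_classical all_reals all_analysis.
Import Order.TTheory GRing.Theory Num.Theory.
Import numFieldNormedType.Exports.

Set Implicit Arguments.
Unset Strict Implicit.
Unset Printing Implicit Defensive.

Local Open Scope classical_set_scope.
Local Open Scope ring_scope.

Section Generalities.
Variable R : realType.

(* The library norm on matrices is the sup norm. *)
Definition enorm {M : nat} (x : 'cV[R]_M) : R :=
  Num.sqrt (\sum_(j < M) x j ord0 ^+ 2).

Definition to_scalar (A : 'M[R]_1) : R := A ord0 ord0.

Definition posdef {M : nat} (H : 'M[R]_M) : Prop :=
  H^T = H /\ forall x : 'cV[R]_M, x != 0 -> 0 < to_scalar (x^T *m H *m x).

Definition trunc (b x : R) : R := Num.max (- b) (Num.min x b).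

End Generalities.

Section Graph.
Variable N : nat.

Definition nbhd (e : rel 'I_N) (n : 'I_N) : {set 'I_N} :=
  [set l : 'I_N | (l == n) || e n l]%SET.

Definition strict_nbhd (e : rel 'I_N) (n : 'I_N) : {set 'I_N} :=
  (nbhd e n :\ n)%SET.

End Graph.

(* [usup_period n] is the transfer period L_n, an element of {1, 2, ...} together
   with infinity; [None] stands for infinity. *)
Record usup (R : realType) (N : nat) := Usup {
  usup_comb : 'I_N -> 'I_N -> R;
  usup_aplus : R;
  usup_mua : 'I_N -> R;
  usup_nu : 'I_N -> R;
  usup_epsp : R;
  usup_period : 'I_N -> option nat }.

Record usup_wf (R : realType) (N : nat) (e : rel 'I_N) (A : usup R N) : Prop := {
  comb_ge0 : forall n l, 0 <= usup_comb A n l;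
  comb_supp : forall n l, l \notin strict_nbhd e n -> usup_comb A n l = 0;
  comb_sum1 : forall n, \sum_(l in strict_nbhd e n) usup_comb A n l = 1;
  aplus_gt0 : 0 < usup_aplus A;
  mua_gt0 : forall n, 0 < usup_mua A n;
  nu_itv : forall n, 0 < usup_nu A n < 1;
  epsp_gt0 : 0 < usup_epsp A;
  period_gt0 : forall n l, usup_period A n = Some l -> (0 < l)%N }.

Record signals (R : realType) (T : Type) (N M : nat) := Signals {
  meas : 'I_N -> nat -> T -> R;
  regr : 'I_N -> nat -> T -> 'rV[R]_M;
  gain : 'I_N -> nat -> T -> 'M[R]_M }.

Record node_state (R : realType) (M : nat) := NodeState {
  st_w : 'cV[R]_M;
  st_psi : 'cV[R]_M;
  st_a : R;
  st_p : R }.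

Section Algorithm.
Variables (R : realType) (T : Type) (N M : nat).
Variables (e : rel 'I_N) (A : usup R N) (S : signals R T N M).

Definition transfer (L : option nat) (i : nat) : bool :=
  if L is Some l then (0 < i)%N && (l %| i)%N else false.

Definition lam (a : R) : R := (1 + expR (- a))^-1.

Definition lam_check (a : R) : R :=
  if a == - usup_aplus A then 0
  else if a == usup_aplus A then 1
  else lam a.

Definition nbhd_estimate (s : 'I_N -> node_state R M) (n : 'I_N) : 'cV[R]_M :=
  \sum_(l in strict_nbhd e n) usup_comb A n l *: st_w (s l).

Definition local_update (n : 'I_N) (i : nat) (om : T) (x : 'cV[R]_M) : 'cV[R]_M :=
  x + gain S n i om *m (regr S n i om)^T
        *m (meas S n i om - to_scalar (regr S n i om *m x))%:M.

(* The states at time [i] from the states [s] at time [i - 1]. *)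
Definition usup_step (i : nat) (om : T) (s : 'I_N -> node_state R M) (n : 'I_N) :
    node_state R M :=
  let u := regr S n i om in
  let a0 := st_a (s n) in
  let psi0 := st_psi (s n) in
  let phi0 := nbhd_estimate s n in
  let lc := lam_check a0 in
  let w := lc *: psi0 + (1 - lc) *: phi0 in
  let err := meas S n i om - to_scalar (u *m w) in
  let y := to_scalar (u *m (psi0 - phi0)) in
  let p := usup_nu A n * st_p (s n) + (1 - usup_nu A n) * `|y| ^+ 2 in
  let a := trunc (usup_aplus A)
    (a0 + usup_mua A n / (p + usup_epsp A) * y * err * lam a0 * (1 - lam a0)) in
  let dl : R := (transfer (usup_period A n) i)%:R in
  let psia := dl *: w + (1 - dl) *: psi0 in
  NodeState w (local_update n i om psia) a p.

Variable init : 'I_N -> T -> node_state R M.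

Fixpoint usup_run (i : nat) (om : T) : 'I_N -> node_state R M :=
  if i is j.+1 then usup_step i om (usup_run j om) else fun n => init n om.

Definition out (n : 'I_N) (i : nat) (om : T) := st_w (usup_run i om n).

Definition filt (n : 'I_N) (i : nat) (om : T) := st_psi (usup_run i om n).

Definition nbhd_est (n : 'I_N) (i : nat) (om : T) :=
  nbhd_estimate (usup_run i om) n.

(* The weight that the local supervisor of [n] applies at time [i + 1]. *)
Definition supervisor (n : 'I_N) (i : nat) (om : T) : R :=
  lam_check (st_a (usup_run i om n)).

Fixpoint standalone (n : 'I_N) (i : nat) (om : T) : 'cV[R]_M :=
  if i is j.+1 then local_update n i om (standalone n j om)
  else st_psi (init n om).

End Algorithm.

Section Probability.
Context {d : measure_display} {T : measurableType d} {R : realType}.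
Variable P : probability T R.

Definition random_mx {m n : nat} (X : T -> 'M[R]_(m, n)) : Prop :=
  forall j k, measurable_fun setT (fun om => X om j k).

Definition finite_moment2 (X : T -> R) : Prop :=
  ('E_P[fun om => (X om ^+ 2)%R] < +oo)%E.

Definition finite_moment2_mx {m n : nat} (X : T -> 'M[R]_(m, n)) : Prop :=
  forall j k, finite_moment2 (fun om => X om j k).

Definition msd {M : nat} (wo : 'cV[R]_M) (x : T -> 'cV[R]_M) : \bar R :=
  'E_P[fun om => (enorm (wo - x om) ^+ 2)%R]%E.

Record signals_wf (N M : nat) (wo : 'cV[R]_M) (v : 'I_N -> nat -> T -> R)
    (S : signals R T N M) : Prop := {
  linear_model : forall n i om,
    meas S n i om = to_scalar (regr S n i om *m wo) + v n i om;
  noise_measurable : forall n i, measurable_fun setT (v n i);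
  regr_measurable : forall n i, random_mx (regr S n i);
  gain_measurable : forall n i, random_mx (gain S n i);
  gain_posdef : forall n i om, posdef (gain S n i om);
  noise_moment2 : forall n i, finite_moment2 (v n i);
  regr_moment2 : forall n i, finite_moment2_mx (regr S n i);
  meas_moment2 : forall n i, finite_moment2 (meas S n i) }.

Record init_wf (N M : nat) (A : usup R N) (init : 'I_N -> T -> node_state R M) :
    Prop := {
  init_w_measurable : forall n, random_mx (fun om => st_w (init n om));
  init_psi_measurable : forall n, random_mx (fun om => st_psi (init n om));
  init_a_measurable : forall n, measurable_fun setT (fun om => st_a (init n om));
  init_p_measurable : forall n, measurable_fun setT (fun om => st_p (init n om));
  init_a_itv : forall n om, - usup_aplus A <= st_a (init n om) <= usup_aplus A;
  init_p_ge0 : forall n om, 0 <= st_p (init n om) }.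

Section Network.
Variables (N M : nat) (e : rel 'I_N) (A : usup R N) (wo : 'cV[R]_M).
Variables (S : signals R T N M) (init : 'I_N -> T -> node_state R M).

Definition estimates_moment2 : Prop := forall n i,
  [/\ finite_moment2_mx (out e A S init n i),
      finite_moment2_mx (filt e A S init n i) &
      finite_moment2_mx (nbhd_est e A S init n i)].

(* Convergence of the supervisors is required in mean only: the weights lie in
   [0, 1], so this follows from their almost sure convergence, from their
   convergence in probability and from stationarity of their laws. *)
Record steady_state (i0 : nat) : Prop := {
  filt_steady : forall n i, (i0 <= i)%N ->
    msd wo (filt e A S init n i) = msd wo (filt e A S init n i0);
  out_steady : forall n i, (i0 <= i)%N ->
    msd wo (out e A S init n i) = msd wo (out e A S init n i0);
  supervisor_steady : forall n, exists lbar : R,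
    'E_P[supervisor e A S init n i]%E @[i --> \oo] --> lbar%:E }.

Definition supervisors_choose_best (i0 : nat) : Prop :=
  forall n i, (i0 <= i)%N ->
    (msd wo (out e A S init n i.+1) <=
       mine (msd wo (filt e A S init n i)) (msd wo (nbhd_est e A S init n i)))%E.

Definition independent_filters : Prop := forall n, usup_period A n = None.

(* In steady state the value of the time index is immaterial, hence the two
   independent times [i] and [j]. *)
Definition universal_noncoop_from (i0 : nat) : Prop :=
  forall n i j, (i0 <= i)%N -> (i0 <= j)%N ->
    (msd wo (out e A S init n i) <= msd wo (standalone S init n j))%E.

End Network.
End Probability.

(* Main.v *)
Require Import Defs.
From HB Require Import structures.
From mathcomp Require Import all_boot all_order all_algebra.
From mathcomp Require Import all_classical all_reals all_analysis.

(** When the supervisor output is never transferred, each local filter obeys the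
    recursion of the stand-alone filter from the same initial condition, so the
    two coincide on every trajectory ([filt_standalone]).  In steady state the
    supervisor makes the output of a node at least as good as its local filter
    estimate one step earlier; since neither MSD depends on time any more, this
    compares the output at any time with the stand-alone filter at any time. *)

Lemma filt_standalone (R : realType) (T : Type) (N M : nat) (e : rel 'I_N)
    (A : usup R N) (S : signals R T N M) (init : 'I_N -> T -> node_state R M)
    (n : 'I_N) :
  usup_period A n = None ->
  forall i, filt e A S init n i = standalone S init n i.
Proof.
move=> Ln i; apply/funext => om.
elim: i => [//|i IHi].
rewrite /filt /= Ln /=.
by rewrite GRing.scale0r GRing.add0r GRing.subr0 GRing.scale1r -IHi.
Qed.

Theorem theorem1 (R : realType) (d : measure_display) (T : measurableType d)
    (P : probability T R) (N M : nat) (e : rel 'I_N) (A : usup R N)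
    (wo : 'cV[R]_M) (v : 'I_N -> nat -> T -> R) (S : signals R T N M)
    (init : 'I_N -> T -> node_state R M) (i0 : nat) :
  symmetric e ->
  usup_wf e A ->
  signals_wf P wo v S ->
  init_wf A init ->
  estimates_moment2 P e A S init ->
  steady_state P e A wo S init i0 ->
  supervisors_choose_best P e A wo S init i0 ->
  independent_filters A ->
  universal_noncoop_from P e A wo S init i0.
Proof.
move=> _ _ _ _ _ steady best indep n i j i0i i0j.
rewrite -(@filt_standalone _ _ _ _ e A S init n (indep n) j).
rewrite (filt_steady steady n i0j) (out_steady steady n i0i).
(* The supervisor property compares the output at time [i0 + 1] with the filter
   at time [i0]. *)
rewrite -(out_steady steady n (leqnSn i0)).
have := best n i0 (leqnn i0).
by rewrite Order.TotalTheory.le_min => /andP[].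
Qed.
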